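(* For every integer $n\ge 0$, let $\mathcal{R}'(n)$ be the set of all $Y\in\mathcal{R}(n)$ that contain the whole bottom row, i.e. $(x,0)\in Y$ for all $x\in\{0,1,\dots,n\}$. Then $$|\mathcal{R}'(n)|=\frac{1}{n+2}\binom{2n+2}{n+1}.$$
   Context: For an integer $n\ge 0$, let $\mathcal{Q}(n)=\{(x,y)\in\mathbb{Z}^2: 0\le x,\ 0\le y,\ x+y\le n\}$. Let $\mathcal{R}(n)$ be the set of all subsets $Y\subseteq\mathcal{Q}(n)$ such that: for any $(a,b),(c,d)\in Y$ with $\max(a,c)+\max(b,d)\le n+1$, we have $(\min(a,c),\min(b,d))\in Y$ and, additionally, $(\max(a,c),\max(b,d))\in Y$ as soon as $(\max(a,c),\max(b,d))\in\mathcal{Q}(n)$. *)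

(* Defs.v *)
From mathcomp Require Import all_boot all_order all_algebra.

Set Implicit Arguments.
Unset Strict Implicit.
Unset Printing Implicit Defensive.

Import Order.TTheory GRing.Theory Num.Theory.

(* Every point (x, y) of Z^2 with 0 <= x, 0 <= y and x + y <= n has both
   coordinates in {0, ..., n}, so the ambient square is taken to be the finite
   type of pairs of elements of 'I_n.+1; it is closed under coordinatewise
   minimum and maximum. *)
Definition point (n : nat) : finType := ('I_n.+1 * 'I_n.+1)%type.

Definition Q (n : nat) : {set point n} := [set p : point n | p.1 + p.2 <= n].

Definition pmin (n : nat) (p q : point n) : point n :=
  (Order.min p.1 q.1, Order.min p.2 q.2).

Definition pmax (n : nat) (p q : point n) : point n :=
  (Order.max p.1 q.1, Order.max p.2 q.2).

(* The threshold is n + 1, whereas pmax p q lies in Q n only up to n: when its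
   coordinates sum to exactly n + 1, only pmin p q is required to be in Y. *)
Definition R (n : nat) : {set {set point n}} :=
  [set Y : {set point n} | (Y \subset Q n) &&
    [forall p in Y, forall q in Y,
       (maxn p.1 q.1 + maxn p.2 q.2 <= n.+1) ==>
       (pmin p q \in Y) && ((pmax p q \in Q n) ==> (pmax p q \in Y))]].

Definition R' (n : nat) : {set {set point n}} :=
  [set Y in R n | [forall x : 'I_n.+1, (x, ord0) \in Y]].

(* Main.v *)
(** Since Y contains the bottom row, closure under maxima makes each row y of Y
    a final segment of the row, say of length v_y. Put h(y) = y + v_y. The
    closure condition then says exactly that h(d) <= h(b) whenever
    b < d <= h(b), i.e. that h is a bracket vector of the Tamari lattice.
    Bracket vectors are built by prepending entries: if t entries can be
    prepended to a vector, its extensions admit 2, ..., t + 1 entries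
    respectively. This is the Catalan generating tree, counted by ballot
    numbers. *)
Require Import Defs.
From mathcomp Require Import all_boot all_order all_algebra.
From mathcomp Require Import zify.

Set Implicit Arguments.
Unset Strict Implicit.
Unset Printing Implicit Defensive.

(** The entries [l] for which [l :: w] remains a bracket vector. After [k] is prepended, 0 survives
    and the old slots shift by one, but only those with [k <= l]: a positive new entry spans the old
    head, so it must reach as far. *)
Fixpoint slots (w : seq nat) : seq nat :=
  if w is k :: w' then 0 :: [seq l.+1 | l <- slots w' & k <= l] else [:: 0].

Fixpoint bracket (w : seq nat) : bool :=
  if w is k :: w' then (k \in slots w') && bracket w' else true.

Lemma slotsP w l :
  l \in slots w <-> l <= size w /\ forall j, j < l -> j + nth 0 w j < l.
Proof.
elim: w l => [|k w IHw] l /=.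
  rewrite inE; split=> [/eqP -> //|[]]; lia.
case: l => [|l]; first by rewrite in_cons eqxx.
rewrite in_cons (mem_map succn_inj) mem_filter /=; split.
  case/andP=> le_kl /IHw [le_lw lt_l]; split=> // -[|j] //= lt_jl.
  by rewrite addSn ltnS lt_l.
case=> le_lw lt_l; apply/andP; split; first by have /= := lt_l 0 isT; lia.
apply/IHw; split=> // j lt_jl; have := lt_l j.+1; rewrite /=; lia.
Qed.

Lemma bracketP v :
  bracket v <-> forall i, i < size v -> i + nth 0 v i < size v /\
    forall j, i < j <= i + nth 0 v i -> j + nth 0 v j <= i + nth 0 v i.
Proof.
elim: v => [|k v IHv] //=; split.
  case/andP=> /slotsP[le_kv lt_k] /IHv bv [_|i lt_iv] /=.
    split=> [|[|j]] //=; rewrite add0n => lt_jk.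
    by have := lt_k j lt_jk; lia.
  have [lt_i le_i] := bv i lt_iv; split=> [|[|j]] //=.
  by move=> ij; have := le_i j; lia.
move=> bv; apply/andP; split.
  apply/slotsP; have [/= lt0 le0] := bv 0 isT; split=> [|j lt_jk]; first lia.
  by have := le0 j.+1; rewrite /=; lia.
apply/IHv => i lt_iv; have [/= lt_i le_i] := bv i.+1 lt_iv.
split=> [|j ij]; first lia.
by have := le_i j.+1; rewrite /=; lia.
Qed.

(** The entry [size w] reaches the end of the vector, so it encloses everything; it will encode the
    full bottom row. *)
Lemma bracket_cons_size w : bracket w -> bracket (size w :: w).
Proof.
move=> bw; rewrite /= bw andbT; apply/slotsP; split=> // j lt_jw.
by have /bracketP /(_ j lt_jw) [] := bw.
Qed.

Lemma slots_sorted w : sorted ltn (slots w).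
Proof.
elim: w => //= k w IHw; rewrite (path_sortedE ltn_trans) all_map.
apply/andP; split; first by apply/allP.
rewrite sorted_map; exact: (sorted_filter ltn_trans).
Qed.

(** The count is the rank of [k] from the top, so it takes each value from 1 to [size s] once. *)
Lemma sum_count_geq (F : nat -> nat) s : sorted ltn s ->
  \sum_(k <- s) F (count (leq k) s) = \sum_(i < size s) F i.+1.
Proof.
elim: s => [|x s IHs] /=; first by rewrite big_nil big_ord0.
rewrite (path_sortedE ltn_trans) => /andP[/allP gt_x ss].
rewrite big_cons big_ord_recr /= addnC leqnn -IHs //; congr (_ + _).
  apply: eq_big_seq => k /gt_x /=.
  by rewrite ltnNge => /negbTE ->.
congr (F _.+1); apply/eqP; rewrite -all_count.
by apply/allP => k /gt_x /ltnW.
Qed.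

Fixpoint brackets (N : nat) : seq (seq nat) :=
  if N is N'.+1 then [seq l :: w | w <- brackets N', l <- slots w]
  else [:: [::]].

Lemma mem_brackets N w : (w \in brackets N) = (size w == N) && bracket w.
Proof.
elim: N w => [|N IHN] [|l w] //=.
  by apply/allpairsPdep => -[? [? []]].
rewrite eqSS; apply/allpairsPdep/idP.
  by case=> w' [l' [+ + [-> ->]]]; rewrite IHN => /andP[-> ->] ->.
by case/and3P=> sw lw bw; exists w, l; rewrite IHN sw bw.
Qed.

Lemma brackets_uniq N : uniq (brackets N).
Proof.
elim: N => //= N IHN; apply: allpairs_uniq_dep => // [w _|].
  exact: (sorted_uniq ltn_trans ltnn (slots_sorted w)).
by move=> [w l] [w' l'] _ _ /= [-> ->].
Qed.

(* The number of nodes at depth N below a node with t children in the Catalan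
   generating tree. *)
Fixpoint descendants (N t : nat) : nat :=
  if N is N'.+1 then \sum_(i < t) descendants N' i.+2 else 1.

(** Prepending the r-th largest slot leaves r + 1 slots, which is the branching rule of the tree;
    the induction trades a level of [N] for one of [k]. *)
Lemma sum_descendants_brackets N k :
  \sum_(w <- brackets N) descendants k (size (slots w)) = descendants (N + k) 1.
Proof.
elim: N k => [|N IHN] k; first by rewrite big_seq1.
rewrite addSnnS -IHN big_allpairs_dep /=; apply: eq_bigr => w _.
under eq_bigr => l _ do rewrite size_map size_filter.
exact: (sum_count_geq (fun t => descendants k t.+1) (slots_sorted w)).
Qed.

Lemma size_brackets N : size (brackets N) = descendants N 1.
Proof. by rewrite -[N in RHS]addn0 -sum_descendants_brackets sum1_size. Qed.

(** Splitting off the last child leaves two smaller instances, which add up by Pascal's rule. *)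
Lemma descendants_ballot N t :
  descendants N.+1 t + 'C(2 * N + t.+1, N) = 'C(2 * N + t.+1, N.+1).
Proof.
elim: N t => [|N IHN] t; first by rewrite /= sum1_card card_ord bin0 bin1; lia.
elim: t => [|t IHt].
  (* Without children both binomials agree by symmetry. *)
  rewrite [descendants _ _]big_ord0 add0n -bin_sub; last by lia.
  by congr 'C(_, _); lia.
rewrite [descendants _ _]big_ord_recr /= -/(descendants N.+2 t).
rewrite -/(descendants N.+1 t.+2) addnS.
have := IHN t.+2; have -> : 2 * N + t.+3 = 2 * N.+1 + t.+1 by lia.
by move: IHt; move: (2 * N.+1 + t.+1) => m; rewrite !binS; lia.
Qed.

Lemma descendants_catalan n :
  n.+2 * descendants n.+1 1 = 'C(2 * n + 2, n + 1).
Proof.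
have := descendants_ballot n 1; have := mul_bin_left (2 * n + 2) n.
rewrite addn1; have -> : 2 * n + 2 - n = n.+2 by lia.
by move: 'C(_, n) 'C(_, n.+1) (descendants _ _) => a b c; nia.
Qed.

Lemma val_min n (i j : 'I_n) : Order.min i j = minn i j :> nat.
Proof. by rewrite /Order.min ltEord /minn; case: ifP. Qed.

Lemma val_max n (i j : 'I_n) : Order.max i j = maxn i j :> nat.
Proof. by rewrite /Order.max ltEord /maxn; case: ifP. Qed.

(** Row [y] consists of its last [v_y] points. Vectors will have [n.+2] entries, since [y + v_y] may
    equal [n.+1]; the last entry is forced to be 0 and belongs to an empty row. *)
Definition right_rows n (v : seq nat) : {set point n} :=
  [set p : point n | p.1 + p.2 <= n < p.1 + p.2 + nth 0 v p.2].

Lemma right_rows_R' n w : size w = n.+1 -> bracket w ->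
  right_rows n (n.+1 :: w) \in R' n.
Proof.
move=> sw bw.
have /bracketP := bracket_cons_size bw; rewrite /= sw => bv.
rewrite !inE -andbA; apply/and3P; split.
- by apply/subsetP => p; rewrite !inE => /andP[].
- apply/forall_inP => -[a b]; rewrite inE /= => /andP[p_le p_gt].
  apply/forall_inP => -[c d]; rewrite inE /= => /andP[q_le q_gt].
  apply/implyP => le_pq; rewrite !inE /= !val_min !val_max.
  have [|lt_b nest_b] := bv b; first by lia.
  have [|lt_d nest_d] := bv d; first by lia.
  have {}nest_b := nest_b d; have {}nest_d := nest_d b.
  (* If [b < d], the threshold gives [a + d <= n.+1], and [p_gt] then gives [d <= b + v_b], so
     [nest_b] applies. *)
  case: (ltngtP b d) => [lt_bd|lt_db|eq_bd]; [lia|lia|].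
  by rewrite eq_bd in p_gt *; lia.
by apply/forallP => x; rewrite inE /=; have := ltn_ord x; lia.
Qed.

Lemma right_rows_inj n v v' : size v = n.+2 -> size v' = n.+2 ->
  bracket v -> bracket v' -> right_rows n v = right_rows n v' -> v = v'.
Proof.
move=> sv sv' /bracketP bv /bracketP bv' eqY.
have no_lt u u' y : y < n.+2 -> y + nth 0 u' y < n.+2 ->
    right_rows n u = right_rows n u' -> ~ nth 0 u y < nth 0 u' y.
  move=> lt_y lt_u' eqU lt_uu'.
  (* This point lies just left of the segment of [u], hence inside that of [u']. *)
  move/setP: eqU => /(_ (inord (n - y - nth 0 u y), inord y)).
  rewrite !inE /= !inordK; lia.
apply: (@eq_from_nth _ 0); first by rewrite sv'.
move=> y; rewrite sv => lt_y.
have [|lt_v _] := bv y; first by rewrite sv.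
have [|lt_v' _] := bv' y; first by rewrite sv'.
rewrite sv in lt_v; rewrite sv' in lt_v'.
have := no_lt v v' y lt_y lt_v' eqY; have := no_lt v' v y lt_y lt_v (esym eqY).
by lia.
Qed.

Lemma R'_right_rows n Y : Y \in R' n ->
  exists2 w, w \in brackets n.+1 & Y = right_rows n (n.+1 :: w).
Proof.
rewrite !inE -andbA => /and3P[/subsetP sYQ /forall_inP clY /forallP rowY].
pose P x y := (inord x, inord y) \in Y.
have P_pt (p : point n) : P p.1 p.2 = (p \in Y).
  by rewrite /P !inord_val; case: p.
have P0 x : P x 0.
  rewrite /P; have -> // : inord 0 = ord0 :> 'I_n.+1.
  by apply: val_inj; rewrite /= inordK.
have P_join a b c d : a + b <= n -> c + d <= n -> P a b -> P c d ->
    maxn a c + maxn b d <= n.+1 -> P (minn a c) (minn b d) /\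
    (maxn a c + maxn b d <= n -> P (maxn a c) (maxn b d)).
  move=> ab cd Pab Pcd le_n.
  have /forall_inP/(_ _ Pcd) := clY _ Pab.
  have [lt_a lt_b] : a < n.+1 /\ b < n.+1 by lia.
  have [lt_c lt_d] : c < n.+1 /\ d < n.+1 by lia.
  rewrite /= !inordK // le_n -!P_pt inE /= !val_min !val_max !inordK //.
  by case/andP=> -> /implyP.
have P_up x x' y : P x y -> x <= x' -> x' + y <= n -> P x' y.
  (* The maximum with a bottom-row point moves right within the row. *)
  move=> Pxy le_x le_n; case: (P_join x y x' 0) => //; try lia.
  by rewrite (maxn_idPr le_x) maxn0 => _; apply.
(* The leftmost point of row [y], or [n.+1 - y] if the row is empty. *)
pose f y := find (P^~ y) (iota 0 (n.+1 - y)).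
have f_le y : f y <= n.+1 - y.
  by have := find_size (P^~ y) (iota 0 (n.+1 - y)); rewrite size_iota.
have f_in y : f y < n.+1 - y -> P (f y) y.
  move=> lt_f; have : has (P^~ y) (iota 0 (n.+1 - y)).
    by rewrite has_find size_iota.
  by move/(nth_find 0); rewrite -/(f y) nth_iota.
have f_min x y : x + y <= n -> P x y = (f y <= x).
  move=> le_n; apply/idP/idP => [Pxy|le_fx].
    rewrite leqNgt; apply/negP => lt_xf.
    have := before_find 0 lt_xf; rewrite nth_iota ?add0n ?Pxy //.
    by have := f_le y; lia.
  by apply: (P_up (f y)) => //; apply: f_in; lia.
have f0 : f 0 = 0 by apply/eqP; rewrite -leqn0 -f_min.
have [v sv vE] : exists2 v, size v = n.+2 &
    forall y, nth 0 v y = n.+1 - y - f y.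
  exists (mkseq (fun y => n.+1 - y - f y) n.+2); first by rewrite size_mkseq.
  move=> y; case: (ltnP y n.+2) => lt_y; first by rewrite nth_mkseq.
  by rewrite nth_default ?size_mkseq //; lia.
have bv : bracket v.
  apply/bracketP => b; rewrite sv => lt_b; rewrite vE.
  have le_fb := f_le b; split=> [|d lt_bd]; first lia.
  rewrite vE; have le_fd := f_le d; rewrite leqNgt; apply/negP => lt_f.
  have Pb := f_in b; have Pd := f_in d.
  (* A failure of nesting means [f d < f b]; the minimum of the two leftmost points then lies in row
     [b] left of [f b]. *)
  case: (P_join (f b) b (f d) d); [lia | lia | apply: Pb; lia
    | apply: Pd; lia | lia |].
  have -> : minn (f b) (f d) = f d by lia.
  have -> : minn b d = b by lia.
  rewrite f_min; lia.
have vcons : v = n.+1 :: behead v.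
  by have := vE 0; rewrite f0 !subn0; case: (v) sv => //= k v' _ ->.
exists (behead v).
  rewrite mem_brackets size_behead sv eqxx /=.
  by move: bv; rewrite vcons /= => /andP[].
rewrite -vcons; apply/setP => -[a b]; rewrite inE vE -P_pt /=.
case: (leqP (a + b) n) => [le_n|gt_n] /=.
  rewrite f_min //; have := f_le b; lia.
by apply/negP; rewrite (P_pt (a, b)) => /sYQ; rewrite inE leqNgt gt_n.
Qed.

Lemma card_R' n : #|R' n| = descendants n.+1 1.
Proof.
rewrite -size_brackets -(size_map (fun w => right_rows n (n.+1 :: w))).
have full w : w \in brackets n.+1 ->
    size (n.+1 :: w) = n.+2 /\ bracket (n.+1 :: w).
  rewrite mem_brackets => /andP[/eqP sw /bracket_cons_size].
  by rewrite /= sw.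
have /card_uniqP <- : uniq [seq right_rows n (n.+1 :: w) | w <- brackets n.+1].
  rewrite map_inj_in_uniq ?brackets_uniq // => w w' /full[sw bw] /full[sw' bw'].
  by case/(right_rows_inj sw sw' bw bw').
apply: eq_card => Y; apply/idP/mapP => [/R'_right_rows //|[w]].
by rewrite mem_brackets => /andP[/eqP sw bw] ->; apply: right_rows_R'.
Qed.

Theorem proposition22 (n : nat) :
  (#|R' n|%:R = n.+2%:R^-1 * 'C(2 * n + 2, n + 1)%:R :> rat)%R.
Proof.
rewrite card_R' -descendants_catalan GRing.natrM GRing.mulKf //.
by rewrite Num.Theory.pnatr_eq0.
Qed.
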